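(* Let $\sigma_{kk}$ be the smallest singular value of $\widetilde{U}_k=M^{1/2}U_kL_k^{-1/2}$ and let $h_{kk}$ be the corresponding right singular vector. Let $c=[c_0,\ldots,c_k]^{T}=L_k^{-1/2}h_{kk}$ be the optimal vector of the SVD-MPE method, assume $\sum_{j=0}^kc_j\ne0$, and let $\gamma=[\gamma_0,\ldots,\gamma_k]^T$ with $\gamma_i=c_i/\sum_{j=0}^kc_j$ be the vector of coefficients of the SVD-MPE approximation $s_{n,k}=\sum_{i=0}^k\gamma_ix_{n+i}$. Then $$\|U_k\gamma\|_M=\frac{\sigma_{kk}}{\big|\sum_{j=0}^kc_j\big|}.$$
   Context: Let $\{x_m\}_{m\ge0}$ be a sequence of vectors in $\mathbb{C}^N$, and put $u_m=x_{m+1}-x_m$. For a fixed integer $n\ge0$ and an integer $k\ge1$ with $k+1\le N$, let $U_k=[\,u_n\,|\,u_{n+1}\,|\,\cdots\,|\,u_{n+k}\,]\in\mathbb{C}^{N\times(k+1)}$. Let $M\in\mathbb{C}^{N\times N}$ and $L_k\in\mathbb{C}^{(k+1)\times(k+1)}$ be hermitian positive definite, with hermitian positive definite square roots $M^{1/2}$, $L_k^{1/2}$, and $L_k^{-1/2}=(L_k^{1/2})^{-1}$. Norms: $\|a\|_M=\sqrt{a^*Ma}$ on $\mathbb{C}^N$, $\|a\|_{L_k}=\sqrt{a^*L_ka}$ on $\mathbb{C}^{k+1}$, $\|a\|_2=\sqrt{a^*a}$. SVD-MPE: let $\sigma_{k0}\ge\cdots\ge\sigma_{kk}$ be the singular values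 of $\widetilde U_k$, and let $h_{kk}$ be a right singular vector for $\sigma_{kk}$, i.e. $\widetilde U_k^*\widetilde U_kh_{kk}=\sigma_{kk}^2h_{kk}$, $\|h_{kk}\|_2=1$. The vector $c=L_k^{-1/2}h_{kk}$ is the optimal solution of $\min_c\|U_kc\|_M$ subject to $\|c\|_{L_k}=1$ used by the method. The SVD-MPE approximation $s_{n,k}=\sum_{i=0}^k\gamma_ix_{n+i}$, $\gamma_i=c_i/\sum_{j=0}^kc_j$, is defined if and only if $\sum_{j=0}^kc_j\ne0$. *)

(* Defs.v *)
From mathcomp Require Import all_boot all_order all_algebra.
From mathcomp Require Import reals.
From mathcomp.real_closed Require Export complex.

Set Implicit Arguments.
Unset Strict Implicit.
Unset Printing Implicit Defensive.

Import Order.TTheory GRing.Theory Num.Theory.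
Local Open Scope ring_scope.
Local Open Scope sesquilinear_scope.

Section Definitions.
Variable C : numClosedFieldType.

Definition hermitian_posdef n (A : 'M[C]_n) : Prop :=
  A \is hermsymmx /\
  forall a : 'cV[C]_n, a != 0 -> 0 < (a^t* *m A *m a) 0 0.

(* S is the (unique) hermitian positive definite square root of A. *)
Definition hpd_sqrt n (A S : 'M[C]_n) : Prop :=
  hermitian_posdef S /\ S *m S = A.

(* Norms take their values in C, as does `|_| on a numClosedFieldType. *)
Definition wnorm n (A : 'M[C]_n) (a : 'cV[C]_n) : C :=
  sqrtC ((a^t* *m A *m a) 0 0).

Definition norm2 n (a : 'cV[C]_n) : C := sqrtC ((a^t* *m a) 0 0).

(* Eigenvalues with algebraic multiplicity, in no particular order: the
   characteristic polynomial is the product of the 'X - z%:P, z ranging over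
   this sequence. *)
Definition eigenvalues n (A : 'M[C]_n) : seq C :=
  sval (closed_field_poly_normal (char_poly A)).

(* The n singular values of an m x n matrix (for n <= m), in nonincreasing
   order.  All the entries are nonnegative reals, so the partial order of C
   is total on them. *)
Definition singular_values m n (A : 'M[C]_(m, n)) : seq C :=
  sort >=%R [seq sqrtC z | z <- eigenvalues (A^t* *m A)].

Definition singular_value m n (A : 'M[C]_(m, n)) (i : nat) : C :=
  nth 0 (singular_values A) i.

Definition right_singular_vector m n (A : 'M[C]_(m, n)) (sigma : C)
    (h : 'cV[C]_n) : Prop :=
  A^t* *m A *m h = sigma ^+ 2 *: h /\ norm2 h = 1.

Definition fdiff N (x : nat -> 'cV[C]_N) (m : nat) : 'cV[C]_N :=
  x m.+1 - x m.

Definition Umx N (x : nat -> 'cV[C]_N) (n k : nat) : 'M[C]_(N, k.+1) :=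
  \matrix_(i < N, j < k.+1) fdiff x (n + j) i 0.

Definition mpe_coef k (c : 'cV[C]_k.+1) : 'cV[C]_k.+1 :=
  \col_(i < k.+1) (c i 0 / \sum_(j < k.+1) c j 0).

Definition mpe_approx N (x : nat -> 'cV[C]_N) (n k : nat)
    (gamma : 'cV[C]_k.+1) : 'cV[C]_N :=
  \sum_(i < k.+1) gamma i 0 *: x (n + i)%N.

End Definitions.

(* Main.v *)
(** Since M = (M^(1/2))^* M^(1/2), the M-norm of U_k c is the 2-norm of
    M^(1/2) U_k c = Utilde h, whose square is h^* Utilde^* Utilde h = sigma^2.
    As sigma >= 0, this norm is sigma, and dividing c by the sum of its entries
    divides it by the modulus of that sum. *)

Require Import Defs.
From mathcomp Require Import all_boot all_order all_algebra.
From mathcomp Require Import reals.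
From mathcomp.real_closed Require Import complex.

Set Implicit Arguments.
Unset Strict Implicit.
Unset Printing Implicit Defensive.

Import Order.TTheory GRing.Theory Num.Theory.
Local Open Scope ring_scope.

Section SingularValues.
Local Open Scope sesquilinear_scope.
Variable C : numClosedFieldType.

Lemma adjmxM m n p (A : 'M[C]_(m, n)) (B : 'M[C]_(n, p)) :
  (A *m B)^t* = B^t* *m A^t*.
Proof. by rewrite trmx_mul map_mxM. Qed.

Lemma adjmxK m n (A : 'M[C]_(m, n)) : A^t*^t* = A.
Proof. by apply/matrixP => i j; rewrite !mxE conjCK. Qed.

Lemma adjmx_mul_cV n (a : 'cV[C]_n) :
  (a^t* *m a) 0 0 = \sum_i `|a i 0| ^+ 2.
Proof. by rewrite mxE; apply: eq_bigr => i _; rewrite !mxE normCK mulrC. Qed.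

Lemma adjmx_mul_cV_ge0 n (a : 'cV[C]_n) : 0 <= (a^t* *m a) 0 0.
Proof. by rewrite adjmx_mul_cV; apply: sumr_ge0 => i _; apply: exprn_ge0. Qed.

(** A sum of squared moduli vanishes only when each term does. This definiteness lets a strictly
    positive factor be cancelled for a nonzero eigenvector. *)
Lemma adjmx_mul_cV_eq0 n (a : 'cV[C]_n) : ((a^t* *m a) 0 0 == 0) = (a == 0).
Proof.
apply/eqP/eqP => [/eqP|->]; last by rewrite mulmx0 mxE.
rewrite adjmx_mul_cV psumr_eq0 => [/allP a0|i _]; last exact: exprn_ge0.
apply/colP => i; rewrite mxE.
by have := a0 i (mem_index_enum i); rewrite expf_eq0 normr_eq0 => /eqP.
Qed.

Lemma norm2Z n (t : C) (a : 'cV[C]_n) : norm2 (t *: a) = `|t| * norm2 a.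
Proof.
rewrite /norm2 !adjmx_mul_cV.
under eq_bigr do rewrite mxE normrM exprMn.
rewrite -mulr_sumr rootCMl ?exprn_ge0 // sqrCK //.
Qed.

Lemma wnorm_hpd_sqrt n (A S : 'M[C]_n) (a : 'cV[C]_n) :
  hpd_sqrt A S -> wnorm A a = norm2 (S *m a).
Proof.
(* The hermitian predicate carries a sign [(-1) ^+ false]; clearing it leaves [S = S^t*]. *)
move=> [[/is_hermitianmxP S_herm _] <-]; rewrite expr0 scale1r in S_herm.
by rewrite /wnorm /norm2 adjmxM -S_herm !mulmxA.
Qed.

Lemma mem_eigenvalues n (A : 'M[C]_n) (z : C) :
  (z \in eigenvalues A) = eigenvalue A z.
Proof.
rewrite eigenvalue_root_char /eigenvalues.
case: closed_field_poly_normal => r /= ->.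
by rewrite (monicP (char_poly_monic A)) scale1r root_prod_XsubC.
Qed.

(* A left eigenvector v of A^* A for z satisfies z |v|^2 = |A v^*|^2. *)
Lemma eigenvalue_gram_ge0 m n (A : 'M[C]_(m, n)) (z : C) :
  eigenvalue (A^t* *m A) z -> 0 <= z.
Proof.
case/eigenvalueP => v vA v_neq0.
have w_neq0 : v^t* != 0.
  by apply: contra v_neq0 => /eqP v0; rewrite -(adjmxK v) v0 trmx0 map_mx0.
have w_gt0 : 0 < (v^t*^t* *m v^t*) 0 0.
  by rewrite lt_def adjmx_mul_cV_eq0 w_neq0 adjmx_mul_cV_ge0.
rewrite -(pmulr_lge0 _ w_gt0) adjmxK.
suff -> : z * (v *m v^t*) 0 0 = ((A *m v^t*)^t* *m (A *m v^t*)) 0 0.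
  exact: adjmx_mul_cV_ge0.
by rewrite adjmxM adjmxK mulmxA -(mulmxA v) vA -scalemxAl [RHS]mxE.
Qed.

(** The singular vector equation involves only [sigma ^+ 2]; this fixes the sign of [sigma]. *)
Lemma singular_value_ge0 m n (A : 'M[C]_(m, n)) (i : nat) :
  0 <= singular_value A i.
Proof.
rewrite /singular_value.
have [le_i|lt_i] := leqP (size (singular_values A)) i.
  (* Past the end of the sequence, [nth] returns its default value 0. *)
  by rewrite nth_default.
have := mem_nth 0 lt_i; rewrite mem_sort => /mapP[z z_eig ->].
by rewrite sqrtC_ge0 (@eigenvalue_gram_ge0 _ _ A) // -mem_eigenvalues.
Qed.

Lemma norm2_right_singular_vector m n (A : 'M[C]_(m, n)) (sigma : C)
    (h : 'cV[C]_n) :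
  0 <= sigma -> right_singular_vector A sigma h -> norm2 (A *m h) = sigma.
Proof.
move=> sigma_ge0 [Ah h1].
(* Squaring the normalization [norm2 h = 1] removes the root. *)
have hh : (h^t* *m h) 0 0 = 1 by rewrite -[LHS]sqrtCK -/(norm2 h) h1 expr1n.
rewrite /norm2 adjmxM -mulmxA (mulmxA (A^t*)) Ah -scalemxAr mxE hh mulr1.
exact: sqrCK.
Qed.

End SingularValues.

(** Written as a scalar multiple of [c], the coefficient vector is open to homogeneity of the
    norm. *)
Lemma mpe_coefE (C : numClosedFieldType) (k : nat) (c : 'cV[C]_k.+1) :
  mpe_coef c = (\sum_(j < k.+1) c j 0)^-1 *: c.
Proof. by apply/colP => i; rewrite !mxE mulrC. Qed.

Theorem theorem1 (R : realType) (N : nat) (x : nat -> 'cV[R[i]]_N)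
    (n k : nat) (k_ge1 : (1 <= k)%N) (k_leN : (k + 1 <= N)%N)
    (M Mhalf : 'M[R[i]]_N) (L Lhalf : 'M[R[i]]_k.+1)
    (M_hpd : hermitian_posdef M) (L_hpd : hermitian_posdef L)
    (Mhalf_sqrt : hpd_sqrt M Mhalf) (Lhalf_sqrt : hpd_sqrt L Lhalf)
    (Utilde : 'M[R[i]]_(N, k.+1))
    (Utilde_def : Utilde = Mhalf *m Umx x n k *m invmx Lhalf)
    (sigma : R[i]) (sigma_def : sigma = singular_value Utilde k)
    (h : 'cV[R[i]]_k.+1) (h_sv : right_singular_vector Utilde sigma h)
    (c : 'cV[R[i]]_k.+1) (c_def : c = invmx Lhalf *m h)
    (sum_c_neq0 : \sum_(j < k.+1) c j 0 != 0)
    (gamma : 'cV[R[i]]_k.+1) (gamma_def : gamma = mpe_coef c)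
    (s : 'cV[R[i]]_N) (s_def : s = mpe_approx x n gamma) :
  wnorm M (Umx x n k *m gamma) = sigma / `|\sum_(j < k.+1) c j 0|.
Proof.
have sigma_ge0 : 0 <= sigma by rewrite sigma_def singular_value_ge0.
rewrite gamma_def mpe_coefE -scalemxAr (wnorm_hpd_sqrt _ Mhalf_sqrt).
rewrite -scalemxAr norm2Z normfV mulrC; congr (_ / _).
(* With the scalar gone, the vector left is [Mhalf *m Umx x n k *m invmx Lhalf *m h], that is
   [Utilde *m h]. *)
rewrite c_def !mulmxA -Utilde_def.
exact: norm2_right_singular_vector.
Qed.
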